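(* Let $\mu$ be any probability measure on $\mathbb{R}$ with a continuous strictly increasing cumulative distribution function $F$ such that for all $\varepsilon>0$ $$\limsup_{t\to\infty}\frac{1-F(t+\varepsilon)}{1-F(t)}<1\qquad\text{and}\qquad\limsup_{t\to-\infty}\frac{F(t)}{F(t+\varepsilon)}<1.$$ Then there exists $k>0$ such that for all $T>10^{6}$ and all $n\in\mathbb{N}$, if $(x_i)_{i=1}^n$ is an i.i.d. sample from $\mu$ with corresponding order statistics $(x_{(i)})_{i=1}^n$, then with probability at least $1-400T^{-1/2}$, $$\sup_{1\le i\le n}|x_{(i)}-x_{(i)}^{*}|\le kT,$$ where $x_{(i)}^{*}=F^{-1}(i/(n+1))$.
   Context: $\mathbb{N}=\{1,2,3,\dots\}$. The order statistics $x_{(1)}\le x_{(2)}\le\dots\le x_{(n)}$ are the sample values arranged in non-decreasing order. $F$ is strictly increasing on all of $\mathbb{R}$, and $F^{-1}:(0,1)\to\mathbb{R}$ is its inverse function. *)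

(* Defs.v *)
From HB Require Import structures.
From mathcomp Require Import all_boot all_order all_algebra.
From mathcomp Require Import all_classical all_reals all_analysis.

Set Implicit Arguments.
Unset Strict Implicit.
Unset Printing Implicit Defensive.

Import Order.TTheory GRing.Theory Num.Theory.
Import numFieldNormedType.Exports.

Local Open Scope classical_set_scope.
Local Open Scope ring_scope.

Definition idR {R : realType} : measurableTypeR R -> R := idfun.

HB.instance Definition _ (R : realType) :=
  @isMeasurableFun.Build _ _ _ _ (@idR R) (@measurable_id _ _ setT).

(* The library's cdf is that of a random variable: the one of mu is the cdf
   of the identity of R under mu. It is made real-valued with fine. *)
Definition mcdf (R : realType) (mu : probability (measurableTypeR R) R)
  (t : R) : R := fine (cdf (idR : {RV mu >-> R}) t).

Lemma mcdfE (R : realType) (mu : probability (measurableTypeR R) R) (t : R) :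
  mcdf mu t = fine (mu `]-oo, t]%classic).
Proof. by []. Qed.

(* For F injective with range ]0, 1[, this is F^-1 on ]0, 1[; its value
   elsewhere is a dummy. *)
Definition cdf_inv (R : realType) (mu : probability (measurableTypeR R) R) :
  R -> R := 'pinv_(fun=> 0) [set: R] (mcdf mu).

Definition mutually_independent (d : measure_display) (Omega : measurableType d)
    (R : realType) (P : probability Omega R) (I : finType)
    (X : I -> {RV P >-> R}) : Prop :=
  forall (J : {set I}) (A : I -> set R), (forall i, measurable (A i)) ->
    P (\bigcap_(i in [set` J]) X i @^-1` A i)
    = (\prod_(i in J) P (X i @^-1` A i))%E.

Definition iid_sample (d : measure_display) (Omega : measurableType d)
    (R : realType) (P : probability Omega R)
    (mu : probability (measurableTypeR R) R) (n : nat)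
    (X : 'I_n -> {RV P >-> R}) : Prop :=
  mutually_independent X /\
  forall (i : 'I_n) (A : set R), measurable A -> distribution P (X i) A = mu A.

(* Indices start at 0: order_stat x i is the (i+1)-th smallest value of x,
   counted with multiplicity. *)
Definition order_stat (R : realType) (n : nat) (x : 'I_n -> R) (i : 'I_n) : R :=
  nth 0 (sort <=%R [seq x j | j : 'I_n]) i.

(* Main.v *)
Require Import Defs.
From mathcomp Require Import all_boot all_order all_algebra.
From mathcomp Require Import all_classical all_reals all_analysis.
From mathcomp Require Import lra ring zify.
Import Order.TTheory GRing.Theory Num.Theory.
Import numFieldNormedType.Exports.
Local Open Scope classical_set_scope.
Local Open Scope ring_scope.

(* The tail conditions make 1 - F (on the right) and F (on the left) decay
   geometrically. Hence, for s >= kT, moving from x to x + s either divides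
   1 - F by T or multiplies F by T, and symmetrically for x - s. If the i-th
   order statistic exceeds x*_i + s, then at least n + 1 - i sample values lie
   above x*_i + s, and at most i - 1 lie below it: in the first case far more
   values than expected lie above, in the second far fewer lie below. A Chernoff
   bound makes this event of probability at most (8/T)^i + (8/T)^(n+1-i), and
   the sum over i, for both signs, is O(1/T). *)

(** * Geometric decay of the tails *)

Lemma limf_esup_lt1 (R : realType) (h : R -> R) (G : set (set R)) :
  (limf_esup (fun t => (h t)%:E) G < 1)%E ->
  exists c, [/\ 0 <= c, c < 1 & exists2 V, G V & forall t, V t -> h t <= c].
Proof.
move=> /ereal_inf_lt[_ [V GV <-] sup_lt1].
(* The maximum with 0 makes the constant nonnegative; when [V] is empty the supremum is [-oo] and
   [fine] sends it to 0. *)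
exists (Num.max 0 (fine (ereal_sup ((fun t => (h t)%:E) @` V)))).
have ub t : V t -> ((h t)%:E <= ereal_sup ((fun t => (h t)%:E) @` V))%E.
  by move=> Vt; apply: ereal_sup_ubound; exists t.
move: (ereal_sup _) sup_lt1 ub => [s| |] //= s1 ub; split.
- by rewrite le_max lexx.
- by rewrite gt_max ltr01 -lte_fin.
- by exists V => // t /ub; rewrite lee_fin le_max => ->; rewrite orbT.
- by rewrite le_max lexx.
- by rewrite gt_max ltr01.
- by exists V => // t /ub.
Qed.

(** The left side is nonincreasing in [j]. A number [j] of steps linear in [T] therefore suffices
    for [T * c ^+ j <= 1]. *)
Lemma exp_le_inv1D (R : realFieldType) (c : R) (j : nat) :
  0 <= c -> c <= 1 -> (1 + j%:R * (1 - c)) * c ^+ j <= 1.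
Proof.
move=> c0 c1; elim: j => [|j IH]; first by rewrite mul0r addr0 expr0 mulr1.
apply: le_trans IH; rewrite exprS mulrA ler_wpM2r ?exprn_ge0//.
rewrite -subr_ge0 -natr1.
have -> : 1 + j%:R * (1 - c) - (1 + (j%:R + 1) * (1 - c)) * c
  = (j%:R + 1) * (1 - c) ^+ 2 by ring.
by rewrite mulr_ge0 ?sqr_ge0// addr_ge0.
Qed.

Lemma geometric_decay (R : realFieldType) (g : R -> R) (c M : R) (j : nat) (t : R) :
  0 <= c -> (forall u, M <= u -> g (u + 1) <= c * g u) -> M <= t ->
  g (t + j%:R) <= c ^+ j * g t.
Proof.
move=> c0 gM Mt; elim: j => [|j IH]; first by rewrite addr0 mul1r.
rewrite -natr1 addrA (le_trans (gM _ _))//.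
  by rewrite (le_trans Mt)// lerDl.
by rewrite exprS -mulrA ler_wpM2l.
Qed.

(* Far to the left it is F that grows by the factor T over a distance kT;
   everywhere else 1 - F shrinks by the factor T. *)
Lemma tail_dichotomy (R : realType) (F : R -> R) (c M : R) :
  {homo F : x y / x <= y} -> (forall x, 0 <= F x) -> (forall x, F x <= 1) ->
  0 <= c -> c < 1 -> 0 <= M ->
  (forall t, M <= t -> 1 - F (t + 1) <= c * (1 - F t)) ->
  (forall t, M <= t -> F (- (t + 1)) <= c * F (- t)) ->
  exists2 k : R, 0 < k & forall T s x, 1 <= T -> k * T <= s ->
    T * (1 - F (x + s)) <= 1 - F x \/ T * F x <= F (x + s).
Proof.
move=> F_nd F_ge0 F_le1 c_ge0 c_lt1 M_ge0 right_decay left_decay.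
(* With [j >= T * b] one has [j * (1 - c) >= T], hence [T * c ^+ j <= 1]. *)
pose b := (1 - c)^-1.
have b_gt0 : 0 < b by rewrite invr_gt0 subr_gt0.
(* Since [j <= T * (b + 1)], this yields [s >= 2 * M + 2 * j], which the intermediate case at the
   end requires. *)
exists (2 * M + 2 * (b + 1)); first by lra.
move=> T s x T_ge1 kT_le.
have [j [j_ge j_le]] : exists j : nat, T * b <= j%:R /\ j%:R <= T * (b + 1).
  have Tb_ge0 : 0 <= T * b by nra.
  exists (Num.truncn (T * b)).+1; split; first by rewrite ltW// truncnS_gt.
  have : (Num.truncn (T * b))%:R <= T * b by rewrite truncn_le.
  rewrite -natr1; lra.
have Tcj : T * c ^+ j <= 1.
  apply: le_trans (exp_le_inv1D _ _ j c_ge0 (ltW c_lt1)).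
  rewrite ler_wpM2r ?exprn_ge0//.
  have : T * b * (1 - c) <= j%:R * (1 - c) by rewrite ler_wpM2r// subr_ge0 ltW.
  by rewrite -mulrA mulVf ?mulr1 ?subr_eq0 ?gt_eqF//; lra.
have js : j%:R <= s by nra.
have shrink (y z : R) : 0 <= z -> y <= c ^+ j * z -> T * y <= z.
  move=> z0 yz; have T0 : 0 <= T by lra.
  apply: le_trans (ler_wpM2l T0 yz) _.
  by rewrite mulrA -[leRHS]mul1r ler_wpM2r.
have [xM|xM] := leP (x + j%:R) (- M).
  right; apply: le_trans (F_nd (x + j%:R) _ _); last by rewrite lerD2l.
  apply: shrink => //.
  have := @geometric_decay _ (F \o -%R) c M j (- (x + j%:R)) c_ge0 left_decay.
  by rewrite /= opprK (_ : - (- _ + _) = x); [apply; lra | ring].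
left; have [Mx|xM'] := leP M x.
  apply: shrink; first by rewrite subr_ge0.
  apply: le_trans (@geometric_decay _ (fun t => 1 - F t) c M j x c_ge0 right_decay Mx).
  by rewrite lerB// F_nd// lerD2l.
(* Here [- M - j < x < M]. The decay starts at [M] instead of [x]: [1 - F M <= 1 - F x], and [x + s]
   still lies beyond [M + j]. *)
apply: (@le_trans _ _ (1 - F M)); last by rewrite lerB// F_nd// ltW.
apply: shrink; first by rewrite subr_ge0.
apply: le_trans (@geometric_decay _ (fun t => 1 - F t) c M j M c_ge0 right_decay (lexx M)).
by rewrite lerB// F_nd//; nra.
Qed.

(** * Chernoff bounds for the number of sample values in a set *)

Lemma measure_bigsetU_le (d : measure_display) (Omega : measurableType d)
    (R : realType) (P : {measure set Omega -> \bar R}) (I : Type) (r : seq I) (Q : pred I)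
    (E : I -> set Omega) :
  (forall i, Q i -> measurable (E i)) ->
  (P (\big[setU/set0]_(i <- r | Q i) E i) <= \sum_(i <- r | Q i) P (E i))%E.
Proof.
move=> mE; elim: r => [|i r IH]; first by rewrite !big_nil measure0.
rewrite !big_cons; case: ifPn => // Qi.
apply: le_trans (measureU2 _ _ _) _; [exact: mE| exact: bigsetU_measurable |].
exact: leeD2l.
Qed.

Definition hits (R : realType) (n : nat) (x : 'I_n -> R) (A : set R) : {set 'I_n} :=
  [set j | x j \in A]%SET.
Arguments hits {R n}.

Section sample.
Variables (d : measure_display) (Omega : measurableType d) (R : realType).
Variables (P : probability Omega R) (mu : probability (measurableTypeR R) R).
Variables (n : nat) (X : 'I_n -> {RV P >-> R}).

(** A general [Q] serves both tails: [leq m] means at least [m] hits, [gtn m] fewer than [m]. *)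
Definition hit_event (A : set R) (Q : pred nat) : set Omega :=
  [set w | Q #|hits (fun j => X j w) A|].

(** The atoms of the hit count: independence turns the probability of each into a product, and every
    hit event is a finite union of them. *)
Let cell (A : set R) (b : {set 'I_n}) : set Omega :=
  \bigcap_(j in [set` [set: 'I_n]%SET]) X j @^-1` (if j \in b then A else ~` A).

Let cellE A b w : cell A b w <-> hits (fun j => X j w) A = b.
Proof.
split=> [cw|<- j _].
  apply/setP => j; rewrite inE.
  have := cw j; rewrite /= inE => /(_ isT).
  by case: ifP => _ Aj; [exact/mem_set | exact/memNset].
by rewrite /= inE; case: ifPn => [/set_mem//|/negP + Aj]; apply; exact/mem_set.
Qed.

Let hit_eventE A Q :
  hit_event A Q = \big[setU/set0]_(b : {set 'I_n} | Q #|b|) cell A b.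
Proof.
rewrite -(bigcup_pred [pred b : {set 'I_n} | Q #|b|]) eqEsubset.
split=> [w Qw|w [b /= Qb /cellE wb]]; last by rewrite /hit_event/= wb.
by exists (hits (fun j => X j w) A); [rewrite /= inE | exact/cellE].
Qed.

Let measurable_cell A b : measurable A -> measurable (cell A b).
Proof.
move=> mA; apply: fin_bigcap_measurable => // j _.
by apply: measurable_funPTI; case: ifP => // _; exact: measurableC.
Qed.

Lemma measurable_hit_event A Q : measurable A -> measurable (hit_event A Q).
Proof.
move=> mA; rewrite hit_eventE; apply: bigsetU_measurable => b _.
exact: measurable_cell.
Qed.

(* Exponential Markov inequality: summing over the set of hitting indices, the
   moment E[z ^ #hits] is the expansion of (zp + (1 - p)) ^ n. *)
Lemma hit_event_le (A : set R) (p : R) (Q : pred nat) (c z : R) :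
  iid_sample mu X -> measurable A -> mu A = p%:E ->
  0 <= c -> 0 <= z -> (forall N, Q N -> 1 <= c * z ^+ N) ->
  (P (hit_event A Q) <= (c * (1 + p * (z - 1)) ^+ n)%:E)%E.
Proof.
move=> [indepX distX] mA muA c_ge0 z_ge0 Qle.
have p_ge0 : 0 <= p by rewrite -lee_fin -muA.
have p_le1 : p <= 1 by rewrite -lee_fin -muA probability_le1.
rewrite hit_eventE; apply: le_trans (measure_bigsetU_le _ _ _ _ _ _ _ _ _) _.
  by move=> b _; exact: measurable_cell.
have Pcell b : P (cell A b) = (\prod_(j < n) (if j \in b then p else 1 - p))%:E.
  rewrite /cell indepX; last by move=> j; case: ifP => // _; exact: measurableC.
  rewrite -prodEFin; apply: eq_big => [j|j _]; first by rewrite inE.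
  have -> B : P (X j @^-1` B) = distribution P (X j) B by [].
  case: ifP => _; rewrite distX ?muA//; last exact: measurableC.
  by rewrite probability_setC// muA.
have prod_ge0 b : 0 <= \prod_(j < n) (if j \in b then p else 1 - p).
  by apply: prodr_ge0 => j _; case: ifP => // _; rewrite subr_ge0.
rewrite (eq_bigr _ (fun b _ => Pcell b)) sumEFin lee_fin.
have -> : (1 + p * (z - 1)) ^+ n = \prod_(j < n) (z * p + (1 - p)).
  by rewrite prodr_const card_ord; congr (_ ^+ _); ring.
(* The comparison is made for each index set [b]: if [Q #|b|] holds, then [c * z ^+ #|b| >= 1];
   otherwise the left term is 0. *)
rewrite (bigA_distr 1 +%R) mulr_sumr big_mkcond/=; apply: ler_sum => b _.
have -> : \prod_(j < n) (if j \in b then z * p else 1 - p)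
    = z ^+ #|b| * \prod_(j < n) (if j \in b then p else 1 - p).
  rewrite -prodr_const (big_mkcond (mem b))/= -big_split/=.
  by apply: eq_bigr => j _; case: ifP => //; rewrite mul1r.
rewrite mulrA; case: ifPn => [/Qle le1|_]; last by rewrite !mulr_ge0 ?exprn_ge0.
by rewrite -[leLHS]mul1r ler_wpM2r.
Qed.

End sample.
Arguments hit_event {d Omega R P n}.

Lemma expR_half_le2 (R : realType) : expR (2^-1 : R) <= 2.
Proof.
have := expR_ge1Dx (- (2^-1 : R)); rewrite expRN => h.
have e0 := expR_gt0 (2^-1 : R).
have := mulfV (lt0r_neq0 e0); nra.
Qed.

Section tails.
Variables (d : measure_display) (Omega : measurableType d) (R : realType).
Variables (P : probability Omega R) (mu : probability (measurableTypeR R) R).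
Variables (n : nat) (X : 'I_n -> {RV P >-> R}).
Hypothesis iidX : iid_sample mu X.
Variables (A : set R) (p : R).
Hypotheses (mA : measurable A) (muA : mu A = p%:E).

Let p_ge0 : 0 <= p. Proof. by rewrite -lee_fin -muA. Qed.
Let p_le1 : p <= 1. Proof. by rewrite -lee_fin -muA probability_le1. Qed.

(** Take [z = T / 2]. As [n * p * T <= m], the moment is at most
    [exp (n * p * z) <= exp (m / 2) <= 2 ^ m]. Dividing by [z ^ m] gives [(4 / T) ^ m], weakened to
    the bound shared with [few_hits_le]. *)
Lemma many_hits_le (T : R) (m : nat) : 2 <= T -> T * p <= m%:R / n.+1%:R ->
  (P (hit_event X A (leq m)) <= ((8 / T) ^+ m)%:E)%E.
Proof.
move=> T_ge2 Tp; have p0 := p_ge0; have p1 := p_le1; have T_gt0 : 0 < T by lra.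
pose z : R := T / 2.
have z_ge1 : 1 <= z by rewrite /z; lra.
have z_gt0 : 0 < z by lra.
have zm_gt0 : 0 < z ^+ m by rewrite exprn_gt0.
apply: le_trans (hit_event_le _ _ _ _ mu _ X A p (leq m) (z ^- m) z iidX mA muA _ _ _) _.
- by rewrite invr_ge0 ltW.
- exact: ltW.
- by move=> N mN; rewrite ler_pdivlMl// mulr1 ler_weXn2l.
rewrite lee_fin.
have npz : n%:R * (p * z) <= m%:R * 2^-1.
  have : n%:R * (T * p) <= m%:R.
    apply: le_trans (_ : n%:R * (m%:R / n.+1%:R) <= _); first by rewrite ler_wpM2l.
    by rewrite mulrCA ler_piMr// ler_pdivrMr// mul1r ler_nat.
  rewrite /z; lra.
have le_exp : (1 + p * (z - 1)) ^+ n <= 2 ^+ m.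
  apply: le_trans (_ : expR (p * z) ^+ n <= _).
    apply: lerXn2r; rewrite ?nnegrE ?expR_ge0//; first by nra.
    by apply: le_trans (expR_ge1Dx _); nra.
  rewrite -expRM_natl (le_trans (_ : _ <= expR (m%:R * 2^-1))) ?ler_expR//.
  by rewrite expRM_natl lerXn2r ?nnegrE ?expR_ge0// expR_half_le2.
apply: le_trans (_ : z ^- m * 2 ^+ m <= _).
  by rewrite ler_wpM2l// invr_ge0 ltW.
rewrite -exprVn -exprMn lerXn2r ?nnegrE ?mulr_ge0 ?invr_ge0 ?ltW//.
rewrite /z invf_div; have : 0 < T^-1 by rewrite invr_gt0.
lra.
Qed.

(** Take [z = 1 / 2] and [c = 2 ^ m]. As [n / (n + 1) >= 1 / 2], one has [n * p >= m * T / 2], so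
    the moment is at most [exp (- n * p / 2) <= exp (- m * T / 4) <= (4 / T) ^ m], the last step by
    [exp u >= u]. *)
Lemma few_hits_le (T : R) (m : nat) : (0 < n)%N -> 0 < T -> T * (m%:R / n.+1%:R) <= p ->
  (P (hit_event X A (gtn m)) <= ((8 / T) ^+ m)%:E)%E.
Proof.
move=> n_gt0 T_gt0 Tp; have p0 := p_ge0; have p1 := p_le1.
apply: le_trans (hit_event_le _ _ _ _ mu _ X A p (gtn m) (2 ^+ m) 2^-1 iidX mA muA _ _ _) _.
- by rewrite exprn_ge0.
- by rewrite invr_ge0.
- move=> N /= Nm; rewrite -(subnK (ltnW Nm)) exprD -mulrA -exprMn divff//.
  by rewrite expr1n mulr1 exprn_ege1// ler1n.
rewrite lee_fin.
have np : m%:R * (T / 4) <= n%:R * (p / 2).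
  have : m%:R * (T / 2) <= n%:R * (T * (m%:R / n.+1%:R)).
    have : 2^-1 <= n%:R / n.+1%:R :> R.
      rewrite ler_pdivlMr// -[n.+1%:R]natr1.
      have : 1 <= n%:R :> R by rewrite ler1n.
      lra.
    have -> : n%:R * (T * (m%:R / n.+1%:R)) = m%:R * T * (n%:R / n.+1%:R) by ring.
    by rewrite mulrA => h; rewrite ler_wpM2l// mulr_ge0// ltW.
  by move=> /le_trans/(_ (ler_wpM2l (ler0n _ n) Tp)); lra.
have le_exp : (1 + p * (2^-1 - 1)) ^+ n <= (4 / T) ^+ m.
  apply: le_trans (_ : expR (- (p / 2)) ^+ n <= _).
    apply: lerXn2r; rewrite ?nnegrE ?expR_ge0//; first by lra.
    by apply: le_trans (expR_ge1Dx _); lra.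
  rewrite -expRM_natl mulrN (le_trans (_ : _ <= expR (- (m%:R * (T / 4))))) ?ler_expR//.
    by rewrite lerN2.
  rewrite -mulrN expRM_natl lerXn2r ?nnegrE ?expR_ge0 ?divr_ge0 ?(ltW T_gt0)// expRN.
  rewrite -[leRHS]invf_div lef_pV2 ?posrE ?expR_gt0 ?divr_gt0//.
  by apply: le_trans (expR_ge1Dx _); rewrite lerDr.
apply: le_trans (_ : 2 ^+ m * (4 / T) ^+ m <= _).
  by rewrite ler_wpM2l// exprn_ge0.
rewrite -exprMn (_ : 2 * (4 / T) = 8 / T)//; ring.
Qed.

End tails.

(** * Order statistics as counts *)

Lemma card_hitsC (R : realType) (n : nat) (x : 'I_n -> R) (A : set R) :
  (#|hits x A| + #|hits x (~` A)|)%N = n.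
Proof.
rewrite -[RHS]card_ord -(cardsC (hits x A)); congr (_ + #|pred_of_set _|)%N.
by apply/setP => j; rewrite !inE in_setC.
Qed.

(** In a sorted list the entries satisfying a downward-closed predicate form a prefix, whose length
    is [count a s]. *)
Lemma nth_sorted_lower (R : realType) (s : seq R) (a : pred R) (i : nat) :
  (forall x y, x <= y -> a y -> a x) -> sorted <=%R s -> (i < size s)%N ->
  a (nth 0 s i) = (i < count a s)%N.
Proof.
move=> a_lower; elim: s i => [//|x s IH] i /= s_path i_size.
have s_sorted := path_sorted s_path.
case: (boolP (a x)) => ax.
  by case: i i_size => [|i] i_size /=; rewrite ?ax// IH.
have s_notin y : y \in s -> ~~ a y.
  move=> ys; apply: contra ax; apply: a_lower.
  by have /allP := order_path_min le_trans s_path; apply.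
have -> : count a s = 0%N.
  by apply/eqP; rewrite -leqn0 leqNgt -has_count -all_predC; exact/allP.
case: i i_size => [|i] i_size /=; first exact: negbTE.
by rewrite ltn0; apply/negbTE/s_notin/mem_nth.
Qed.

(** Sorting preserves counts, so events on order statistics become hit events of half-lines, closed
    or open. *)
Lemma order_stat_lower (R : realType) (n : nat) (x : 'I_n -> R) (A : set R) (i : 'I_n) :
  (forall y z, y <= z -> A z -> A y) ->
  A (order_stat x i) <-> (i < #|hits x A|)%N.
Proof.
move=> A_lower; rewrite /order_stat.
have sz : size (sort <=%R [seq x j | j : 'I_n]) = n.
  by rewrite size_sort size_map size_enum_ord.
have -> : #|hits x A| = count (mem A) (sort <=%R [seq x j | j : 'I_n]).
  rewrite count_sort count_map -size_filter cardE; congr size.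
  by rewrite {1}/enum_mem -enumT; apply: eq_filter => j; rewrite /= !inE.
rewrite -nth_sorted_lower ?sz//.
- by rewrite /= inE.
- by move=> y z yz; rewrite /= !inE; exact: A_lower.
- exact/sort_sorted/le_total.
Qed.

(** * The distribution function and its inverse *)

Section cdf_facts.
Variables (R : realType) (mu : probability (measurableTypeR R) R).

Lemma mcdf_EFin (t : R) : mu `]-oo, t]%classic = (mcdf mu t)%:E.
Proof. by rewrite mcdfE fineK ?fin_num_measure//; exact: measurable_itv. Qed.

Lemma mcdf_ge0 (t : R) : 0 <= mcdf mu t.
Proof. by rewrite fine_ge0. Qed.

Lemma mcdf_le1 (t : R) : mcdf mu t <= 1.
Proof. by rewrite -lee_fin -mcdf_EFin probability_le1//; exact: measurable_itv. Qed.

Lemma cvg_mcdfNy : mcdf mu x @[x --> -oo] --> (0 : R).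
Proof. exact: (fine_cvg (@cvg_cdfNy0 _ _ _ _ (idR : {RV mu >-> R}))). Qed.

Lemma cvg_mcdfy : mcdf mu x @[x --> +oo] --> (1 : R).
Proof. exact: (fine_cvg (@cvg_cdfy1 _ _ _ _ (idR : {RV mu >-> R}))). Qed.

Lemma cdf_invK (q : R) : continuous (mcdf mu) -> 0 < q -> q < 1 ->
  mcdf mu (cdf_inv mu q) = q.
Proof.
move=> F_cont q_gt0 q_lt1; apply: pinvK; rewrite inE.
have [a [_ Fa]] : \forall t \near -oo%R, mcdf mu t < q.
  exact: (cvgr_lt _ cvg_mcdfNy).
have [b [_ Fb]] : \forall t \near +oo%R, q < mcdf mu t.
  exact: (cvgr_gt _ cvg_mcdfy).
(* The order of [a] and [b] is unknown; these points lie strictly beyond both and satisfy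
   [a' <= b'], as the intermediate value theorem demands. *)
pose a' := Num.min a b - 1; pose b' := Num.max a b + 1.
have qa : mcdf mu a' < q by apply: Fa; rewrite /a' ltrBlDr ltr_pwDr// ge_min lexx.
have qb : q < mcdf mu b' by apply: Fb; rewrite /b' ltr_pwDr// le_max lexx orbT.
have [|||c _ <-] := @IVT R (mcdf mu) a' b' q; last by exists c.
- have : Num.min a b <= Num.max a b by rewrite ge_min !le_max lexx.
  rewrite /a' /b'; lra.
- exact: continuous_subspaceT.
- by rewrite ge_min le_max (ltW qa) (ltW qb) orbT.
Qed.

End cdf_facts.

(** * Probability bounds for one rank, and their summation *)

Lemma sum_geometric_le (R : realFieldType) (r : R) (n : nat) :
  0 <= r -> r <= 2^-1 -> \sum_(i < n) r ^+ i.+1 <= 2 * r.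
Proof.
move=> r_ge0 r_le; elim: n => [|n IH]; first by rewrite big_ord0 mulr_ge0.
rewrite big_ord_recl expr1; under eq_bigr => i _ do rewrite exprS.
rewrite -mulr_sumr; move: IH; set S := \sum_(i < n) _ => IH.
have : r * S <= r * (2 * r) by rewrite ler_wpM2l.
nra.
Qed.

Section union_bound.
Variables (d : measure_display) (Omega : measurableType d) (R : realType).
Variables (P : probability Omega R) (mu : probability (measurableTypeR R) R).
Variables (n : nat) (X : 'I_n -> {RV P >-> R}).
Hypotheses (n_gt0 : (0 < n)%N) (iidX : iid_sample mu X).
Variable T : R.
Hypothesis T_ge2 : 2 <= T.

(** The hits of [A] and of its complement add up to [n], whence thresholds adding up to [n.+1]. *)
Lemma hit_eventC (A : set R) (m m' : nat) : (m + m' = n.+1)%N ->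
  hit_event X A (gtn m) = hit_event X (~` A) (leq m').
Proof.
move=> mm'; apply/seteqP; rewrite /hit_event; split=> w /=;
have := card_hitsC _ _ (fun j => X j w) A;
move: #|hits _ A| #|hits _ (~` A)| => a b; lia.
Qed.

(** Each alternative bounds the event by one of the two powers: the first through many hits of the
    complement, the second through few hits of [A]. The sum covers both. *)
Lemma hits_lt_le (A : set R) (p : R) (m m' : nat) :
  (m + m' = n.+1)%N -> measurable A -> mu A = p%:E ->
  T * (1 - p) <= m'%:R / n.+1%:R \/ T * (m%:R / n.+1%:R) <= p ->
  (P (hit_event X A (gtn m)) <= ((8 / T) ^+ m + (8 / T) ^+ m')%:E)%E.
Proof.
move=> mm' mA muA alt.
have T_gt0 : 0 < T by apply: lt_le_trans T_ge2.
have rho_ge0 k : 0 <= (8 / T) ^+ k by rewrite exprn_ge0// divr_ge0// ltW.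
case: alt => [many|few].
  have -> : hit_event X A (gtn m) = hit_event X (~` A) (leq m').
    exact: hit_eventC.
  have muAC : mu (~` A) = (1 - p)%:E by rewrite probability_setC// muA.
  apply: le_trans (many_hits_le _ _ _ _ mu _ X iidX _ _ _ muAC T m' T_ge2 many) _.
    exact: measurableC.
  by rewrite lee_fin lerDr.
apply: le_trans (few_hits_le _ _ _ _ mu _ X iidX _ _ mA muA T m n_gt0 T_gt0 few) _.
by rewrite lee_fin lerDl.
Qed.

Lemma hits_ge_le (A : set R) (p : R) (m m' : nat) :
  (m + m' = n.+1)%N -> measurable A -> mu A = p%:E ->
  T * p <= m%:R / n.+1%:R \/ T * (m'%:R / n.+1%:R) <= 1 - p ->
  (P (hit_event X A (leq m)) <= ((8 / T) ^+ m + (8 / T) ^+ m')%:E)%E.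
Proof.
move=> mm' mA muA alt.
have -> : hit_event X A (leq m) = hit_event X (~` A) (gtn m').
  by rewrite -[A in LHS]setCK; apply/esym/hit_eventC; rewrite addnC.
rewrite addrC; apply: (hits_lt_le _ (1 - p)).
- by rewrite addnC.
- exact: measurableC.
- by rewrite probability_setC// muA.
- by rewrite opprB addrC subrK.
Qed.

End union_bound.

(** * From the limsup hypotheses to the theorem *)

Lemma tail_decay (R : realType) (F : R -> R) :
  (forall x, 0 < F x) -> (forall x, F x < 1) ->
  (limf_esup (fun t : R => ((1 - F (t + 1)) / (1 - F t))%:E) +oo%R < 1)%E ->
  (limf_esup (fun t : R => (F t / F (t + 1))%:E) -oo%R < 1)%E ->
  exists c M : R, [/\ 0 <= c, c < 1, 0 <= M,
    forall t, M <= t -> 1 - F (t + 1) <= c * (1 - F t) &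
    forall t, M <= t -> F (- (t + 1)) <= c * F (- t)].
Proof.
move=> F_gt0 F_lt1.
move=> /limf_esup_lt1[c [c0 c1 [V [M [_ VM]] Vle]]].
move=> /limf_esup_lt1[c' [c'0 c'1 [V' [M' [_ VM']] Vle']]].
have MM := ler_norm M; have MM' := ler_norm (- M'); rewrite normrN in MM'.
(* A single threshold: for [t] above it, [t > M] and [- (t + 1) < M'], so both ratio bounds
   apply. *)
exists (Num.max c c'), (`|M| + `|M'| + 1); split.
- by rewrite le_max c0.
- by rewrite gt_max c1.
- by rewrite !addr_ge0.
- move=> t Mt; have G_gt0 : 0 < 1 - F t by rewrite subr_gt0.
  rewrite -ler_pdivrMr// le_max Vle//; apply: VM.
  have := normr_ge0 M'; lra.
- move=> t Mt; rewrite -ler_pdivrMr// (_ : - t = - (t + 1) + 1); last by ring.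
  rewrite le_max Vle' ?orbT//; apply: VM'.
  have := normr_ge0 M; lra.
Qed.

(** A real [sup] is meaningful only for nonempty bounded sets: [0 < n] gives an element, and the sum
    of the absolute values is an upper bound. *)
Lemma sup_finite_leP (R : realType) (n : nat) (f : 'I_n -> R) (a : R) : (0 < n)%N ->
  sup [set f i | i in [set: 'I_n]] <= a <-> forall i, f i <= a.
Proof.
move=> n_gt0; split=> [le_a i|f_le]; last first.
  apply: ge_sup; first by exists (f (Ordinal n_gt0)), (Ordinal n_gt0).
  by move=> _ [i _ <-].
apply: le_trans le_a; apply: ub_le_sup; last by exists i.
exists (\sum_j `|f j|) => _ [j _ <-].
by rewrite (bigD1 j)//= (le_trans (ler_norm _))// lerDl sumr_ge0.
Qed.

Lemma inv_le_powR_half (R : realType) (T : R) : 1 <= T -> T^-1 <= T `^ (- 2^-1).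
Proof.
move=> T_ge1; have T_gt0 : 0 < T by apply: lt_le_trans T_ge1.
by rewrite -(powR_inv1 (ltW T_gt0)) ler_powR//; lra.
Qed.

Theorem theorem3 (R : realType) (mu : probability (measurableTypeR R) R)
  (F_continuous : continuous (mcdf mu))
  (F_increasing : {homo mcdf mu : x y / x < y})
  (right_tail : forall eps : R, 0 < eps ->
    (limf_esup
       (fun t : R => ((1 - mcdf mu (t + eps)) / (1 - mcdf mu t))%:E) +oo%R
     < 1)%E)
  (left_tail : forall eps : R, 0 < eps ->
    (limf_esup
       (fun t : R => (mcdf mu t / mcdf mu (t + eps))%:E) -oo%R
     < 1)%E) :
  exists2 k : R, 0 < k &
    forall (T : R) (n : nat), 10 ^+ 6 < T -> (0 < n)%N ->
    forall (d : measure_display) (Omega : measurableType d)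
      (P : probability Omega R) (X : 'I_n -> {RV P >-> R}),
      iid_sample mu X ->
      ((1 - 400 * T `^ (- 2^-1))%:E <=
       P [set w : Omega |
           (sup [set `|order_stat (fun j => X j w) i
                       - cdf_inv mu (i.+1%:R / n.+1%:R)| | i in [set: 'I_n]]
            <= k * T)%R])%E.
Proof.
have F_nd : {homo mcdf mu : x y / x <= y}.
  by move=> x y; rewrite le_eqVlt => /predU1P[->//|/F_increasing/ltW].
have F_gt0 x : 0 < mcdf mu x.
  by apply: le_lt_trans (mcdf_ge0 R mu (x - 1)) _; apply: F_increasing; lra.
have F_lt1 x : mcdf mu x < 1.
  by apply: lt_le_trans (mcdf_le1 R mu (x + 1)); apply: F_increasing; lra.
have [c [M [c_ge0 c_lt1 M_ge0 decay_r decay_l]]] :=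
  tail_decay _ _ F_gt0 F_lt1 (right_tail 1 ltr01) (left_tail 1 ltr01).
have [k k_gt0 dich] := tail_dichotomy _ _ _ _ F_nd (fun x => ltW (F_gt0 x))
  (fun x => ltW (F_lt1 x)) c_ge0 c_lt1 M_ge0 decay_r decay_l.
(* For moves to the left, the dichotomy is applied to the reflection [1 - F (- x)], which exchanges
   the two tails. *)
have [k' k'_gt0 dich'] : exists2 k' : R, 0 < k' & forall T s x, 1 <= T -> k' * T <= s ->
    T * mcdf mu (x - s) <= mcdf mu x \/ T * (1 - mcdf mu x) <= 1 - mcdf mu (x - s).
  have [|||||k' k'_gt0 dich'] :=
    tail_dichotomy R (fun x => 1 - mcdf mu (- x)) c M _ _ _ c_ge0 c_lt1 M_ge0.
  - by move=> x y xy; rewrite lerB// F_nd// lerN2.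
  - by move=> x; rewrite subr_ge0 ltW.
  - by move=> x; rewrite gerBl ltW.
  - by move=> t Mt; rewrite !subKr; exact: decay_l.
  - by move=> t Mt; rewrite !opprK; exact: decay_r.
  exists k' => // T s x T1 kTs; have := dich' T s (- x) T1 kTs.
  by rewrite !subKr opprD !opprK.
exists (Num.max k k'); first by rewrite lt_max k_gt0.
move=> T n T_gt n_gt0 d Omega P X iidX.
(* The value 16 makes the ratio [8 / T] at most 1/2. *)
have T_ge : 16 <= T.
  by apply: le_trans (ltW T_gt); rewrite -natrX ler_nat.
have T_ge1 : 1 <= T by lra.
have T_ge2 : 2 <= T by lra.
have T_gt0 : 0 < T by lra.
set s := Num.max k k' * T.
have ks : k * T <= s by rewrite ler_wpM2r ?(ltW T_gt0)// le_max lexx.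
have k's : k' * T <= s by rewrite ler_wpM2r ?(ltW T_gt0)// le_max lexx orbT.
pose q (i : 'I_n) : R := i.+1%:R / n.+1%:R.
pose x i := cdf_inv mu (q i).
(* A closed [hi] and an open [lo] make [bad i] exactly the failure of the non-strict bound at rank
   [i]: at most [i] values in [hi i], or at least [i.+1] in [lo i]. *)
pose hi (i : 'I_n) : set (measurableTypeR R) := `]-oo, x i + s]%classic.
pose lo (i : 'I_n) : set (measurableTypeR R) := `]-oo, x i - s[%classic.
have mhi i : measurable (hi i) by exact: measurable_itv.
have mlo i : measurable (lo i) by exact: measurable_itv.
pose bad i := hit_event X (hi i) (gtn i.+1)
  `|` hit_event X (lo i) (leq i.+1).
have mbad i : measurable (bad i).
  apply: measurableU; first exact: (measurable_hit_event _ _ _ _ _ X _ _ (mhi i)).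
  exact: (measurable_hit_event _ _ _ _ _ X _ _ (mlo i)).
have hiP i w : order_stat (fun j => X j w) i <= x i + s <->
    (i < #|hits (fun j => X j w) (hi i)|)%N.
  rewrite -(order_stat_lower _ _ _ (hi i)); first by rewrite /hi/= in_itv.
  by move=> y z; rewrite /hi/= !in_itv/=; exact: le_trans.
have loP i w : order_stat (fun j => X j w) i < x i - s <->
    (i < #|hits (fun j => X j w) (lo i)|)%N.
  rewrite -(order_stat_lower _ _ _ (lo i)); first by rewrite /lo/= in_itv.
  by move=> y z; rewrite /lo/= !in_itv/=; exact: le_lt_trans.
rewrite (_ : [set w | _] = ~` \big[setU/set0]_(i < n) bad i); last first.
  rewrite -(bigcup_pred predT) setC_bigcup; apply/seteqP; split=> w /=.
    move=> /(sup_finite_leP _ _ _ _ n_gt0) close i _; have := close i.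
    rewrite ler_distl => /andP[lo_le /hiP le_hi] [].
      by rewrite /hit_event/= ltnS leqNgt le_hi.
    by rewrite /hit_event/= => /loP; rewrite ltNge lo_le.
  move=> good; apply/(sup_finite_leP _ _ _ _ n_gt0) => i; have := good i isT.
  rewrite /bad => /not_orP[/negP + nlo]; rewrite -leqNgt => /hiP le_hi.
  by rewrite ler_distl le_hi andbT leNgt; apply/negP => /loP.
rewrite probability_setC; last by apply: bigsetU_measurable.
(* The complementary thresholds [i.+1] and [n - i], divided by [n.+1], are the values of [F] and
   [1 - F] at [x i]. *)
have nE (i : 'I_n) : (i.+1 + (n - i) = n.+1)%N by rewrite addSn subnKC// ltnW.
have FxE i : mcdf mu (x i) = q i.
  apply: cdf_invK => //; first by rewrite divr_gt0.
  by rewrite ltr_pdivrMr// mul1r ltr_nat ltnS.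
have FCxE i : 1 - mcdf mu (x i) = (n - i)%:R / n.+1%:R.
  rewrite FxE /q natrB ?(ltnW (ltn_ord i))// -[i.+1%:R]natr1 -[n.+1%:R]natr1.
  by field; rewrite natr1 pnatr_eq0.
have Pbad i : (P (bad i) <= (2 * ((8 / T) ^+ i.+1 + (8 / T) ^+ (n - i)))%:E)%E.
  apply: le_trans (measureU2 _ _ _) _.
  - exact: (measurable_hit_event _ _ _ _ _ X _ _ (mhi i)).
  - exact: (measurable_hit_event _ _ _ _ _ X _ _ (mlo i)).
  rewrite mulrDl !mul1r EFinD leeD//.
    apply: (hits_lt_le _ _ _ _ mu _ _ n_gt0 iidX _ T_ge2 _ _ _ _ (nE i) (mhi i) (mcdf_EFin _ _ _)).
    by rewrite -FCxE -/(q i) -FxE; exact: dich.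
  have lo_fin : mu (lo i) = (fine (mu (lo i)))%:E by rewrite fineK// fin_num_measure//; exact: mlo.
  apply: (hits_ge_le _ _ _ _ mu _ _ n_gt0 iidX _ T_ge2 _ _ _ _ (nE i) (mlo i) lo_fin).
  rewrite -FCxE -/(q i) -FxE.
  (* The open half-line has mass at most [F (x i - s)], and both alternatives persist when the mass
     decreases. *)
  have lo_le : fine (mu (lo i)) <= mcdf mu (x i - s).
    rewrite -lee_fin -lo_fin -mcdf_EFin; apply: le_measure; rewrite ?inE;
      [exact: mlo | exact: measurable_itv |].
    by apply: subset_itvl; rewrite bnd_simp.
  case: (dich' T s (x i) T_ge1 k's) => h; [left|right].
    by apply: le_trans h; rewrite ler_wpM2l// ltW.
  by apply: le_trans h _; rewrite lerB.
have rho_ge0 : 0 <= 8 / T by rewrite divr_ge0// ltW.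
have rho_le : 8 / T <= 2^-1 by rewrite ler_pdivrMr//; lra.
have Pbads : (P (\big[setU/set0]_(i < n) bad i) <= (400 * T `^ (- 2^-1))%:E)%E.
  apply: le_trans (measure_bigsetU_le _ _ _ _ _ _ _ _ (fun i _ => mbad i)) _.
  apply: le_trans (lee_sum _ (fun i _ => Pbad i)) _.
  rewrite sumEFin lee_fin -mulr_sumr big_split/=.
  (* Reversing the ranks identifies the two geometric sums. *)
  have -> : \sum_(i < n) (8 / T) ^+ (n - i) = \sum_(i < n) (8 / T) ^+ i.+1.
    rewrite (reindex_inj rev_ord_inj)/=; apply: eq_bigr => i _.
    by rewrite subKn.
  (* Each sum is at most [16 / T], so the total is at most [64 / T], below the claimed bound because
     [1 / T] is at most the inverse square root of [T]. *)
  have := sum_geometric_le _ _ n rho_ge0 rho_le.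
  have := inv_le_powR_half _ T T_ge1; have := powR_ge0 T (- 2^-1).
  move: (\sum_(i < n) _) (T `^ _) => S u u0 Tu.
  lra.
by rewrite EFinB leeB.
Qed.
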